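(* For any (non-empty) totally bounded set $F$ in a metric space, we have \[ \dim_{\mathrm{A}}^\theta F \to \overline{\dim}_{\mathrm{B}}F \] as $\theta \to 0$.
   Context: For a subset $E$ of a metric space and $r>0$, $N(E,r)$ denotes the minimal number of balls of radius $r$ required to cover $E$, and $B(x,R)$ is the ball of radius $R$ centred at $x$. For $\theta\in(0,1)$, the Assouad spectrum of $F$ at $\theta$ is \[ \dim_{\mathrm A}^{\theta} F = \inf\Big\{\alpha : \exists C>0,\ \exists \rho>0,\ \forall\, 0<R\leq\rho,\ \forall x\in F,\ N(B(x,R)\cap F,R^{1/\theta})\leq C \big(R/R^{1/\theta}\big)^{\alpha}\Big\}. \] The upper box dimension of a totally bounded set $F$ is $\overline{\dim}_{\mathrm B}F=\limsup_{R\to0}\frac{\log N(F,R)}{-\log R}$. *)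

(* Defs.v *)
From HB Require Import structures.
From mathcomp Require Import all_boot all_order all_algebra.
From mathcomp Require Import all_classical all_reals all_analysis.

Set Implicit Arguments.
Unset Strict Implicit.
Unset Printing Implicit Defensive.

Import Order.TTheory GRing.Theory Num.Theory.
Import numFieldNormedType.Exports.

Local Open Scope classical_set_scope.
Local Open Scope ring_scope.

(* The balls [ball c r] of a [metricType] are open; the centres in [s] range
   over the whole space and need not lie in [E]. *)
Definition ball_cover (R : realType) (X : metricType R)
    (E : set X) (r : R) (s : seq X) : Prop :=
  E `<=` \bigcup_(c in [set` s]) ball c r.

Definition totally_bounded (R : realType) (X : metricType R)
    (E : set X) : Prop :=
  forall r : R, 0 < r -> exists s : seq X, ball_cover E r s.

(* Extended-real valued, so that it is [+oo] when no finite cover exists; when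
   one does exist the infimum is attained (see [covering_numberE]). *)
Definition covering_number (R : realType) (X : metricType R)
    (E : set X) (r : R) : \bar R :=
  ereal_inf [set ((size s)%:R%:E : \bar R) | s in ball_cover E r].

Lemma covering_numberE (R : realType) (X : metricType R) (E : set X) (r : R)
    (s : seq X) : ball_cover E r s ->
  (forall t : seq X, ball_cover E r t -> (size s <= size t)%N) ->
  covering_number E r = (size s)%:R%:E.
Proof.
move=> Es smin; apply/eqP; rewrite eq_le; apply/andP; split.
  by apply: ereal_inf_lbound; exists s.
by apply: le_ereal_inf_tmp => _ [t Et <-]; rewrite lee_fin ler_nat smin.
Qed.

Definition assouad_spectrum (R : realType) (X : metricType R)
    (F : set X) (theta : R) : \bar R :=
  ereal_inf [set alpha%:E | alpha in [set alpha : R |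
    exists C rho : R, [/\ 0 < C, 0 < rho &
      forall r : R, 0 < r <= rho -> forall x : X, F x ->
        (covering_number (ball x r `&` F) (r `^ theta^-1)
          <= (C * (r / r `^ theta^-1) `^ alpha)%:E)%E]]].

Definition upper_box_dim (R : realType) (X : metricType R)
    (F : set X) : \bar R :=
  limf_esup (fun r : R => (lne (covering_number F r) / (- ln r)%:E)%E) 0^'+.

(* Main.v *)
Require Import Defs.
From HB Require Import structures.
From mathcomp Require Import all_boot all_order all_algebra.
From mathcomp Require Import all_classical all_reals all_analysis.
From mathcomp Require Import ring lra.
Set Implicit Arguments.
Unset Strict Implicit.
Unset Printing Implicit Defensive.

Import Order.TTheory GRing.Theory Num.Theory.
Import numFieldNormedType.Exports.
Local Open Scope classical_set_scope.
Local Open Scope ring_scope.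

(** Everything is read off the function [H t = ln N(F, e^-t)], nondecreasing
    and nonnegative in the logarithmic scale [t = - ln r].  The upper box
    dimension [d] is the limsup of [H t / t] at infinity, and passing from the
    radius [r] to [r `^ theta^-1] is multiplying the scale by [theta^-1].  The
    theorem follows by squeezing from
    [d <= assouad_spectrum F theta <= d / (1 - theta)] for [0 < theta < 1].

    Upper bound ([assouad_spectrum_le]): a ball in [F] costs at most as much as
    [F] itself, and if [H t <= beta * t] then, with [r = e^-(theta * t)],
    [N(F, e^-t) <= e^(beta * t) = (r / e^-t) `^ (beta / (1 - theta))].

    Lower bound ([upper_box_dim_le_assouad_spectrum]): cover [F] by balls of
    radius [r / 2] and each of their traces on [F], which lies in a ball of
    radius [r] centred in [F], by balls of radius [e^-t].  If [alpha] is
    admissible in the definition of the spectrum, this gives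
    [H t <= H (theta * t + ln 2) + ln C + alpha * (1 - theta) * t]
    ([log_cover_rec]).  Iterating it forces [H] to grow at most like
    [beta * t] for every [beta > alpha] ([affine_growth]), hence [d <= alpha].
    Because the iteration presupposes no a priori bound on [H], the lower
    bound also covers [d = +oo], where the spectrum is then constantly
    [+oo]. *)

(** * Covering numbers *)

Lemma covering_number_attained (R : realType) (X : metricType R) (E : set X)
    (r : R) (s : seq X) : ball_cover E r s ->
  exists2 t, ball_cover E r t & covering_number E r = (size t)%:R%:E.
Proof.
move=> Es.
have ex_size : exists n, `[< exists2 t, ball_cover E r t & size t = n >].
  by exists (size s); apply/asboolP; exists s.
case: (ex_minnP ex_size) => n /asboolP[t Et tn] nmin.
exists t => //; apply: covering_numberE => // u Eu.
by rewrite tn; apply: nmin; apply/asboolP; exists u.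
Qed.

(** Extracts an actual cover from a bound: finiteness of the infimum provides
    some finite cover, hence one of minimal size. *)
Lemma covering_number_le_cover (R : realType) (X : metricType R) (E : set X)
    (r M : R) : (covering_number E r <= M%:E)%E ->
  exists2 t, ball_cover E r t & (size t)%:R <= M.
Proof.
move=> NM; have : (covering_number E r < (M + 1)%:E)%E.
  by apply: le_lt_trans NM _; rewrite lte_fin; lra.
move/ereal_inf_lt => [_ [s Es _] _].
have [t Et Nt] := covering_number_attained Es.
by exists t => //; rewrite -lee_fin -Nt.
Qed.

Lemma le_covering_number (R : realType) (X : metricType R) (E E' : set X)
    (r r' : R) : E `<=` E' -> r' <= r ->
  (covering_number E r <= covering_number E' r')%E.
Proof.
move=> EE' r'r; apply: ereal_inf_le_tmp => _ [s E's <-]; exists s => // x Ex.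
by have [c cs xc] := E's x (EE' x Ex); exists c => //; exact: le_ball xc.
Qed.

Lemma ball_cover_bigcup (R : realType) (X : metricType R) (A : X -> set X)
    (r M : R) (s : seq X) :
  (forall c, c \in s -> exists2 t, ball_cover (A c) r t & (size t)%:R <= M) ->
  exists2 t, ball_cover (\bigcup_(c in [set` s]) A c) r t &
    (size t)%:R <= (size s)%:R * M.
Proof.
elim: s => [|c s IHs] As; first by exists [::]; [move=> x []|rewrite mul0r].
have [t At tM] := As c (mem_head _ _).
have [|u Au uM] := IHs.
  by move=> d ds; apply: As; rewrite in_cons ds orbT.
exists (t ++ u).
  2: by rewrite size_cat natrD -[size (c :: s)]add1n natrD mulrDl mul1r lerD.
move=> x [d /=]; rewrite in_cons => /orP[/eqP-> /At|ds Ad].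
  by case=> e et xe; exists e => //=; rewrite mem_cat et.
have [|e eu xe] := Au x; first by exists d.
by exists e => //=; rewrite mem_cat [e \in u]eu orbT.
Qed.

(** The balls of radius [r / 2] are centred anywhere in [X], whereas the local
    bound concerns balls centred in [F].  Halving the radius repairs this: a
    ball of radius [r / 2] that meets [F] at [x] lies in [ball x r]. *)
Lemma covering_number_two_scales (R : realType) (X : metricType R)
    (F : set X) (r s n M : R) : 0 <= M ->
  (covering_number F (r / 2) <= n%:E)%E ->
  (forall x, F x -> (covering_number (ball x r `&` F) s <= M%:E)%E) ->
  (covering_number F s <= (n * M)%:E)%E.
Proof.
move=> M0 /covering_number_le_cover[cs Fcs csn] localN.
have [c ccs|t Ft tM] :=
    @ball_cover_bigcup R X (fun c => ball c (r / 2) `&` F) s M cs.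
  have [[x [xc Fx]]|nx] := pselect (ball c (r / 2) `&` F !=set0); last first.
    by exists [::] => // x cx; exfalso; apply: nx; exists x.
  have [t xt tM] := covering_number_le_cover (localN x Fx).
  exists t => // y [yc Fy]; apply: xt; split => //; exact: ball_splitr yc.
have Fst : ball_cover F s t.
  by move=> x Fx; have [c ccs xc] := Fcs x Fx; apply: Ft; exists c.
apply: (@le_trans _ _ (size t)%:R%:E).
  by apply: ereal_inf_lbound; exists t.
by rewrite lee_fin; apply: le_trans tM _; exact: ler_wpM2r.
Qed.

(** * Covering numbers in logarithmic scale *)

Definition log_cover (R : realType) (X : metricType R) (F : set X) (t : R) :
    R :=
  ln (fine (covering_number F (expR (- t)))).

Section log_cover_theory.
Variables (R : realType) (X : metricType R) (F : set X).
Hypotheses (F_nonempty : F !=set0) (F_tb : totally_bounded F).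

Lemma covering_number_fin_ge1 (r : R) : 0 < r ->
  exists2 n : R, 1 <= n & covering_number F r = n%:E.
Proof.
move=> r0; have [s Fs] := F_tb r0.
have [t Ft Nt] := covering_number_attained Fs.
exists (size t)%:R => //; rewrite ler1n lt0n size_eq0; apply/eqP => t0.
by have [x Fx] := F_nonempty; have [c] := Ft x Fx; rewrite t0.
Qed.

Lemma covering_number_expR t :
  covering_number F (expR (- t)) = (expR (log_cover F t))%:E.
Proof.
have [n n1 Nn] := covering_number_fin_ge1 (expR_gt0 (- t)).
by rewrite /log_cover Nn /= lnK// posrE (lt_le_trans ltr01).
Qed.

Lemma log_cover_ge0 t : 0 <= log_cover F t.
Proof.
have [n n1 Nn] := covering_number_fin_ge1 (expR_gt0 (- t)).
by rewrite /log_cover Nn /= ln_ge0.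
Qed.

Lemma le_log_cover : {homo log_cover F : t u / t <= u}.
Proof.
move=> t u tu.
have : (covering_number F (expR (- t)) <= covering_number F (expR (- u)))%E.
  by apply: le_covering_number => //; rewrite ler_expR lerN2.
by rewrite !covering_number_expR lee_fin ler_expR.
Qed.

(** The two-scale estimate with [r = expR (- (theta * t))], for which
    [r `^ theta^-1 = expR (- t)]; the summand [ln 2] comes from halving [r]. *)
Lemma log_cover_rec (theta C alpha t : R) : 0 < theta -> 0 < C ->
  (forall x, F x ->
    (covering_number (ball x (expR (- (theta * t))) `&` F)
        (expR (- (theta * t)) `^ theta^-1)
      <= (C * (expR (- (theta * t)) / expR (- (theta * t)) `^ theta^-1)
                `^ alpha)%:E)%E) ->
  log_cover F t
    <= log_cover F (theta * t + ln 2) + (ln C + alpha * (1 - theta) * t).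
Proof.
move=> theta0 C0.
have -> : expR (- (theta * t)) `^ theta^-1 = expR (- t).
  by rewrite -expRM; congr expR; field; rewrite gt_eqF.
rewrite -expRN -expRD -expRM => localN.
have : (covering_number F (expR (- t))
    <= (expR (log_cover F (theta * t + ln 2))
        * (C * expR (alpha * (1 - theta) * t)))%:E)%E.
  apply: (@covering_number_two_scales _ _ _ (expR (- (theta * t)))).
  - by rewrite mulr_ge0 ?expR_ge0// ltW.
  - have -> : expR (- (theta * t)) / 2 = expR (- (theta * t + ln 2)).
      by rewrite opprD expRD (expRN (ln 2)) lnK ?posrE.
    by rewrite covering_number_expR.
  - move=> x Fx; apply: le_trans (localN x Fx) _; rewrite lee_fin.
    rewrite le_eqVlt; apply/orP; left; apply/eqP; congr (_ * expR _); ring.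
by rewrite covering_number_expR lee_fin -{1}[C]lnK// -!expRD ler_expR.
Qed.

End log_cover_theory.

(** Past some [t0] the scale [theta * t + c] precedes [t] by at least [1], so
    an induction over windows of length [1] reaches every [t].  The bound
    [A + beta * t] reproduces itself: the margin
    [(beta - alpha) * (1 - theta) * t] absorbs the constant [beta * c + K]
    once [t] is large.  Only [A] depends on the size of [H] before [t0]. *)
Lemma affine_growth (R : realType) (H : R -> R) (theta c K alpha beta : R) :
  {homo H : t u / t <= u} -> 0 < theta < 1 -> 0 <= c -> alpha < beta ->
  (\forall t \near +oo,
    H t <= H (theta * t + c) + (K + alpha * (1 - theta) * t)) ->
  exists A, \forall t \near +oo, H t <= A + beta * t.
Proof.
move=> Hmono /andP[theta0 theta1] c0 ab Hrec.
have theta1' : 0 < 1 - theta by rewrite subr_gt0.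
have gap0 : 0 < (beta - alpha) * (1 - theta) by rewrite mulr_gt0// subr_gt0.
have [T [_ HT]] : \forall t \near +oo,
    [/\ H t <= H (theta * t + c) + (K + alpha * (1 - theta) * t),
        theta * t + c <= t - 1 &
        beta * c + K <= (beta - alpha) * (1 - theta) * t].
  near=> t; split; first by near: t.
  - suff : 1 + c <= (1 - theta) * t by lra.
    by rewrite -ler_pdivrMl.
  - by rewrite -ler_pdivrMl.
pose t0 := `|T|; pose A := H t0 + `|beta| * t0.
have t0_ge0 : 0 <= t0 by rewrite normr_ge0.
(* For n = 0 monotonicity suffices; the term in `|beta| serves beta < 0. *)
have bounded n t : 0 <= t <= t0 + n%:R -> H t <= A + beta * t.
  elim: n t => [|n IHn] t /andP[t_ge0 tn].
    rewrite addr0 in tn; have := Hmono _ _ tn.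
    have : - (beta * t) <= `|beta| * t0.
      apply: le_trans (ler_norm _) _.
      by rewrite normrN normrM (ger0_norm t_ge0) ler_wpM2l.
    by rewrite /A; lra.
  have [tt0|t0t] := leP t t0; first by apply: IHn; rewrite t_ge0 ler_wpDr.
  have [Ht step gap] := HT t (le_lt_trans (ler_norm T) t0t).
  have : H (theta * t + c) <= A + beta * (theta * t + c).
    apply: IHn; rewrite addr_ge0 ?mulr_ge0 ?(ltW theta0)//=.
    by move: tn; rewrite -natr1; lra.
  by move: Ht gap; lra.
exists A; near=> t; apply: (bounded (Num.truncn t).+1); apply/andP; split.
  by near: t; apply: nbhs_pinfty_ge; rewrite num_real.
by rewrite ler_wpDl// ltW// truncnS_gt.
Unshelve. all: by end_near. Qed.

(** * The box dimension and the Assouad spectrum *)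

Section dimensions.
Variables (R : realType) (X : metricType R) (F : set X).
Hypotheses (F_nonempty : F !=set0) (F_tb : totally_bounded F).
Local Notation H := (log_cover F).

Lemma box_ratioE (r : R) : 0 < r < 1 ->
  (lne (covering_number F r) / (- ln r)%:E)%E = (H (- ln r) / (- ln r))%:E.
Proof.
move=> /andP[r0 r1]; have lnr : 0 < - ln r by rewrite oppr_gt0 ln_lt0// r0.
have := covering_number_expR F_nonempty F_tb (- ln r).
rewrite opprK lnK ?posrE// => ->.
by rewrite lne_EFin ?expR_gt0// expRK inver gt_eqF// -EFinM.
Qed.

Lemma upper_box_dim_le (beta : R) :
  (\forall t \near +oo, H t <= beta * t) -> (upper_box_dim F <= beta%:E)%E.
Proof.
move=> [T [_ HT]].
apply: ge_ereal_inf; exists (ereal_sup ((fun r : R =>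
   (lne (covering_number F r) / (- ln r)%:E)%E) @`
     [set r | 0 < r < expR (- `|T|)])).
  exists [set r : R | 0 < r < expR (- `|T|)] => //.
  near=> r; apply/andP; split; near: r; first exact: nbhs_right_gt.
  exact/nbhs_right_lt/expR_gt0.
apply: ge_ereal_sup => _ [r /andP[r0 rT] <-].
have tT : `|T| < - ln r by rewrite ltrNr -ltr_expR lnK.
have t0 : 0 < - ln r by apply: le_lt_trans tT.
rewrite box_ratioE; last by rewrite r0 /= -ltr_ln ?posrE// ln1 -oppr_gt0.
by rewrite lee_fin ler_pdivrMr// HT// (le_lt_trans (ler_norm _) tT).
Unshelve. all: by end_near. Qed.

(** Together with [upper_box_dim_le], this identifies the upper box dimension
    with the limsup of [H t / t] at infinity. *)
Lemma log_cover_le_of_upper_box_dim (beta : R) :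
  (upper_box_dim F < beta%:E)%E ->
  \forall t \near +oo, H t <= beta * t.
Proof.
move=> /ereal_inf_lt[_ [V V0 <-] Vbeta].
have [e /= e0 Ve] := V0.
near=> t.
have t0 : 0 < t by near: t; apply: nbhs_pinfty_gt; rewrite num_real.
have Vt : V (expR (- t)).
  apply: Ve; last exact: expR_gt0.
  rewrite /= sub0r normrN gtr0_norm ?expR_gt0// -[e]lnK// ltr_expR ltrNl.
  by near: t; apply: nbhs_pinfty_gt; rewrite num_real.
have := le_lt_trans (ereal_sup_ubound (imageP _ Vt)) Vbeta.
rewrite box_ratioE ?expRK ?opprK ?expR_gt0 ?expR_lt1 ?oppr_lt0//.
by rewrite lte_fin ltr_pdivrMr// => /ltW.
Unshelve. all: by end_near. Qed.

Lemma upper_box_dim_ge0 : (0 <= upper_box_dim F)%E.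
Proof.
rewrite leNgt; apply/negP => /ereal_inf_lt[b bV b0].
(* A negative upper box dimension would make H eventually negative. *)
have [b' b'0 bb'] : exists2 b' : R, b' < 0 & (b < b'%:E)%E.
  have [-> |bE] := eqVneq b -oo%E.
    by exists (-1); rewrite ?ltNyr// oppr_lt0.
  case: b b0 bE {bV} => // b b0 _.
  by exists (b / 2); rewrite ?lte_fin in b0 *; lra.
have : (upper_box_dim F < b'%:E)%E.
  by apply: le_lt_trans bb'; exact: ereal_inf_lbound.
move/log_cover_le_of_upper_box_dim => Hb'.
suff : \forall t \near (+oo : set_system R), False by move=> /filter_ex[].
near=> t.
have : H t <= b' * t by near: t.
apply/negP; rewrite -ltNge (@lt_le_trans _ _ 0)// ?log_cover_ge0//.
rewrite nmulr_rlt0//; by near: t; apply: nbhs_pinfty_gt; rewrite num_real.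
Unshelve. all: by end_near. Qed.

Lemma upper_box_dim_le_affine (A beta : R) :
  (\forall t \near +oo, H t <= A + beta * t) -> (upper_box_dim F <= beta%:E)%E.
Proof.
move=> HA; apply/lee_addgt0Pr => e e0; rewrite -EFinD; apply: upper_box_dim_le.
near=> t; apply: (@le_trans _ _ (A + beta * t)); first by near: t.
by rewrite mulrDl addrC lerD2l mulrC -ler_pdivrMr.
Unshelve. all: by end_near. Qed.

(** An admissible exponent [alpha] turns into the recursion for [H], whose
    solutions exceed [(alpha + e) * t] by a bounded amount, for any [e > 0]. *)
Lemma upper_box_dim_le_assouad_spectrum (theta : R) : 0 < theta < 1 ->
  (upper_box_dim F <= assouad_spectrum F theta)%E.
Proof.
move=> theta01; have /andP[theta0 _] := theta01.
apply: le_ereal_inf_tmp => _ [alpha [C [rho [C0 rho0 Hloc]]] <-].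
apply/lee_addgt0Pr => e e0; rewrite -EFinD.
have [A HA] : exists A, \forall t \near +oo, H t <= A + (alpha + e) * t.
  apply: (@affine_growth _ _ theta (ln 2) (ln C) alpha) => //.
  - exact: le_log_cover.
  - by rewrite ln_ge0// ler1n.
  - by rewrite ltrDl.
  - near=> t; apply: log_cover_rec => // x Fx; apply: Hloc => //.
    rewrite expR_gt0 /= -[rho]lnK// ler_expR lerNl -ler_pdivrMl//.
exact: upper_box_dim_le_affine HA.
Unshelve. all: by end_near. Qed.

(** The trace of a ball on [F] is covered by covering the whole of [F].  The
    factor [1 - theta] is the exponent of the ratio of the two radii,
    [expR (- (theta * t)) / expR (- t) = expR ((1 - theta) * t)]. *)
Lemma assouad_spectrum_le (theta beta : R) : 0 < theta < 1 ->
  (\forall t \near +oo, H t <= beta * t) ->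
  (assouad_spectrum F theta <= (beta / (1 - theta))%:E)%E.
Proof.
move=> /andP[theta0 theta1] [T [_ HT]].
apply: ereal_inf_lbound; exists (beta / (1 - theta)) => //.
exists 1, (expR (- (theta * (`|T| + 1)))); split => //; first exact: expR_gt0.
move=> r /andP[r0 rT] x Fx.
pose t := - ln r / theta.
have rE : r = expR (- (theta * t)).
  by rewrite /t mulrC divfK ?gt_eqF// opprK lnK.
have tT : T < t.
  apply: le_lt_trans (ler_norm T) _.
  move: rT; rewrite rE ler_expR lerN2 ler_pM2l//; lra.
have -> : r `^ theta^-1 = expR (- t).
  by rewrite rE -expRM; congr expR; field; rewrite gt_eqF.
rewrite {2}rE -expRN -expRD -expRM mul1r.
have -> : (- (theta * t) - - t) * (beta / (1 - theta)) = beta * t.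
  by field; rewrite subr_eq0 gt_eqF.
apply: (@le_trans _ _ (covering_number F (expR (- t)))).
  by apply: le_covering_number => // y [].
by rewrite covering_number_expR// lee_fin ler_expR HT.
Qed.

End dimensions.

Theorem corollary3p2 (R : realType) (X : metricType R) (F : set X)
    (F_nonempty : F !=set0) (F_tb : totally_bounded F) :
  assouad_spectrum F theta @[theta --> (0 : R)^'+] --> upper_box_dim F.
Proof.
have near01 : \forall theta \near (0 : R)^'+, 0 < theta < 1.
  near=> theta; apply/andP; split; near: theta; first exact: nbhs_right_gt.
  exact: nbhs_right_lt.
have := upper_box_dim_ge0 F_nonempty F_tb.
case dimE : (upper_box_dim F) => [d| |] // d0.
- apply: (@squeeze_cvge _ _ _ _ (cst d%:E) _
    (fun theta => (d / (1 - theta))%:E)).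
  + near=> theta; have theta01 : 0 < theta < 1 by near: theta.
    have theta1 : 0 < 1 - theta by rewrite subr_gt0; case/andP: theta01.
    rewrite -{1}dimE upper_box_dim_le_assouad_spectrum//=.
    apply/lee_addgt0Pr => e e0; rewrite -EFinD.
    have -> : d / (1 - theta) + e = (d + e * (1 - theta)) / (1 - theta).
      by rewrite mulrDl mulfK ?gt_eqF.
    apply: assouad_spectrum_le => //.
    apply: log_cover_le_of_upper_box_dim => //.
    by rewrite dimE lte_fin ltrDl mulr_gt0.
  + exact: cvg_cst.
  + apply: cvg_EFin; first exact: nearW.
    apply: cvg_at_right_filter.
    rewrite -[X in _ --> X]divr1 -[X in _ / X](subr0 1).
    apply: cvgM; first exact: cvg_cst.
    apply: cvgV; first by rewrite subr0 oner_neq0.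
    by apply: cvgB; [exact: cvg_cst|exact: cvg_id].
- apply: cvg_near_cst; near=> theta.
  apply/eqP; rewrite -leye_eq -dimE.
  apply: upper_box_dim_le_assouad_spectrum => //.
  by near: theta.
Unshelve. all: by end_near. Qed.
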